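(* Let $A$ be an $n\times n$ nonnegative matrix such that $\operatorname{per}(A)\neq 0$, and let $e$ be the identity element of $S_n$. Then there exists $\tau\in S_n$ such that $L_e(AP_\tau)\neq 0$. Moreover, for any such $\tau$, $\operatorname{per}(A^k)=\det(A^k)$ for all $k\in\mathbb{N}$ if and only if the following statements hold: (1) $\tau\in A_n$; (2) $\operatorname{per}(A)=L_\tau(A)$; (3) $\operatorname{per}(A^s)=L_e(A^s)$, where $s$ is the order of $\tau$.
   Context: $\mathbb{N}$ is the set of positive integers; $S_n$ is the symmetric group on $\{1,\dots,n\}$ and $A_n$ (the group) is the alternating group of even permutations. A nonnegative matrix is a matrix whose entries are all nonnegative real numbers; $A_{ij}$ is the $(i,j)$-entry of the matrix $A$. $\operatorname{per}(A)=\sum_{\sigma\in S_n}\prod_{i=1}^n A_{i\sigma(i)}$ is the permanent, and $L_\sigma(A)=\prod_{i=1}^n A_{i\sigma(i)}$ for $\sigma\in S_n$. For $\sigma\in S_n$, $P_\sigma$ is the $n\times n$ permutation matrix with $(P_\sigma)_{ij}=1$ if $i=\sigma(j)$ and $0$ otherwise; thus $(AP_\tau)_{ij}=A_{i\,\tau(j)}$. *)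

(* Defs.v *)
From HB Require Import structures.
From mathcomp Require Import all_boot all_order all_algebra all_fingroup.
From mathcomp Require Import alt reals.

Set Implicit Arguments.
Unset Strict Implicit.
Unset Printing Implicit Defensive.

Import Order.TTheory GRing.Theory Num.Theory.
Local Open Scope ring_scope.

Definition diag_prod (R : comPzRingType) (n : nat) (s : 'S_n) (A : 'M[R]_n) : R :=
  \prod_(i < n) A i (s i).

Definition permanent (R : comPzRingType) (n : nat) (A : 'M[R]_n) : R :=
  \sum_(s : 'S_n) diag_prod s A.

(* The entry (i, j) is 1 iff i = s j, whereas [perm_mx s] has it iff s i = j. *)
Definition col_perm_mx (R : comPzRingType) (n : nat) (s : 'S_n) : 'M[R]_n :=
  \matrix_(i, j) (i == s j)%:R.

Lemma col_perm_mxE (R : comPzRingType) (n : nat) (s : 'S_n) :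
  col_perm_mx R s = perm_mx s^-1%g.
Proof.
apply/matrixP=> i j; rewrite !mxE; congr (nat_of_bool _)%:R.
by rewrite -(inj_eq (@perm_inj _ s^-1%g)) permK.
Qed.

Lemma mulmx_col_perm (R : comPzRingType) (n : nat) (A : 'M[R]_n) (s : 'S_n) i j :
  (A *m col_perm_mx R s) i j = A i (s j).
Proof.
rewrite mxE (bigD1 (s j)) //= !mxE eqxx mulr1 big1 ?addr0 // => k kj.
by rewrite mxE (negbTE kj) mulr0.
Qed.

(* Main.v *)
(** Nonnegativity turns everything into statements about supports: [per = det]
    says that every permutation supported by the matrix is even, and
    [per = L_s] that [s] is the only supported one.  Since [tau] is supported
    by [A], a walk of length [k] followed by [k * (s - 1)] steps of [tau] shows
    that if [sigma] is supported by [A ^ k], then [tau^-k sigma] is supported by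
    [(A ^ s) ^ k].  When [A ^ s] supports only the identity, its digraph has no
    cycle besides loops, so neither does that of [(A ^ s) ^ k], and
    [sigma = tau ^ k] is even.  Conversely, if [A ^ s], whose diagonal is
    nonzero, supports some [rho <> 1] moving [i], then padding with loops shows
    that [(A ^ s) ^ #[rho]] supports the odd transposition [(i, rho i)]. *)
Require Import Defs.
From HB Require Import structures.
From mathcomp Require Import all_boot all_order all_algebra all_fingroup.
From mathcomp Require Import alt reals.

Set Implicit Arguments.
Unset Strict Implicit.
Unset Printing Implicit Defensive.

Import Order.TTheory GRing.Theory Num.Theory.
Local Open Scope ring_scope.

Lemma diag_prod_neq0P (R : idomainType) (n : nat) (s : 'S_n) (A : 'M[R]_n) :
  reflect (forall i, A i (s i) != 0) (diag_prod s A != 0).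
Proof.
apply: (iffP (prodf_neq0 _ _)) => [h i|h i _]; last exact: h.
exact: h.
Qed.

Section NonnegativeMatrices.
Variables (R : realDomainType) (n : nat).
Implicit Types (A B : 'M[R]_n) (s t : 'S_n).

Definition mx_ge0 A := forall i j, 0 <= A i j.

Lemma diag_prod_ge0 A s : mx_ge0 A -> 0 <= diag_prod s A.
Proof. by move=> A0; apply: prodr_ge0. Qed.

Lemma mx_ge0_mul A B : mx_ge0 A -> mx_ge0 B -> mx_ge0 (A * B).
Proof. by move=> A0 B0 i j; rewrite mxE sumr_ge0 // => k _; rewrite mulr_ge0. Qed.

Lemma mx_ge0_exp A k : mx_ge0 A -> mx_ge0 (A ^+ k).
Proof.
move=> A0; elim: k => [|k IHk]; first by move=> i j; rewrite expr0 mxE ler0n.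
by rewrite exprS; apply: mx_ge0_mul.
Qed.

Lemma mulmx_neq0P A B i j : mx_ge0 A -> mx_ge0 B ->
  reflect (exists2 k, A i k != 0 & B k j != 0) ((A * B) i j != 0).
Proof.
move=> A0 B0; rewrite mxE psumr_neq0; last by move=> k _; rewrite mulr_ge0.
apply: (iffP hasP) => [[k _ /=]|[k Ak Bk]].
  by move/lt0r_neq0; rewrite mulf_eq0 negb_or => /andP[]; exists k.
by exists k; rewrite ?mem_index_enum //= lt0r mulf_neq0 ?mulr_ge0.
Qed.

Lemma expmx_perm_neq0 A s k i : mx_ge0 A -> (forall i, A i (s i) != 0) ->
  (A ^+ k) i ((s ^+ k)%g i) != 0.
Proof.
move=> A0 As; elim: k i => [|k IHk] i.
  by rewrite expg0 perm1 expr0 mxE eqxx oner_eq0.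
rewrite exprS expgS permM; apply/mulmx_neq0P => //; first exact: mx_ge0_exp.
by exists (s i).
Qed.

Lemma expmx_loop_neq0 A k l i j : mx_ge0 A -> (forall i, A i i != 0) ->
  (k <= l)%N -> (A ^+ k) i j != 0 -> (A ^+ l) i j != 0.
Proof.
move=> A0 Aii /subnKC <- Aij; rewrite exprD.
apply/mulmx_neq0P; [exact: mx_ge0_exp|exact: mx_ge0_exp|exists j => //].
have := @expmx_perm_neq0 A 1%g (l - k) j A0.
by rewrite expg1n !perm1; apply=> x; rewrite perm1.
Qed.

Lemma permanent_diag_prodP A s : mx_ge0 A ->
  (permanent A = diag_prod s A) <->
  (forall t, diag_prod t A != 0 -> t = s).
Proof.
move=> A0; rewrite /permanent (bigD1 s) //=; split=> [|h].
  rewrite -[RHS]addr0 => /addrI /psumr_eq0P h t; apply: contraNeq => ts.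
  by apply/eqP/h => // u _; apply: diag_prod_ge0.
rewrite big1 ?addr0 // => t; apply: contraNeq => At.
by apply/eqP/h.
Qed.

(** The difference of [permanent A] and [\det A] is twice the sum of the terms of odd permutations.
    These are nonnegative, so it vanishes only when each of them does. *)
Lemma permanent_detP A : mx_ge0 A ->
  (permanent A = \det A) <-> (forall s, diag_prod s A != 0 -> ~~ odd_perm s).
Proof.
move=> A0.
have dE : permanent A - \det A = \sum_(s : 'S_n) (diag_prod s A *+ 2) *+ odd_perm s.
  rewrite /permanent /determinant -sumrB; apply: eq_bigr => s _.
  by case: (odd_perm s); rewrite ?expr1 ?expr0 ?mulN1r ?opprK ?mul1r ?subrr.
split=> [/eqP|h].
  rewrite -subr_eq0 dE psumr_eq0; last first.
    by move=> s _; rewrite !mulrn_wge0 ?diag_prod_ge0.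
  move=> /allP h s; apply: contraNN => os.
  by have := h s (mem_index_enum s); rewrite os /= mulr1n mulrn_eq0.
apply/eqP; rewrite -subr_eq0 dE big1 // => s _.
have [->|/h/negbTE ->] := eqVneq (diag_prod s A) 0; first by rewrite !mul0rn.
by rewrite mulr0n.
Qed.

(** Loops are left out, so that a nonempty cycle of edges yields a permutation other than the
    identity. *)
Definition mx_edge A : rel 'I_n := fun i j => (i != j) && (A i j != 0).

(* A cyclic walk through two vertices contains a simple cycle, which loops
   complete to a supported permutation. *)
Lemma mx_edge_acyclic A i j : (forall i, A i i != 0) ->
  (forall s, diag_prod s A != 0 -> s = 1%g) ->
  connect (mx_edge A) i j -> connect (mx_edge A) j i -> i = j.
Proof.
move=> Aii A1 /connectP[[|x p] /= ip -> //] ji.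
case/andP: ip => ix xp.
have /connectP[q0 xq0 iE0] : connect (mx_edge A) x i.
  by apply: connect_trans ji; apply/connectP; exists p.
case/shortenP: xq0 iE0 => q xq uq _ iE.
have cq : path.cycle (mx_edge A) (x :: q) by rewrite /= rcons_path xq -iE.
(* [next] turns the cycle and fixes every vertex off it, where the loops supply the nonzero
   entries. *)
have next_inj : injective (next (x :: q)) := can_inj (prev_next uq).
have /A1 next1 : diag_prod (perm next_inj) A != 0.
  apply/diag_prod_neq0P => y; rewrite permE.
  have [yq|yq] := boolP (y \in x :: q).
    by have /andP[] := next_cycle cq yq.
  by rewrite next_nth (negbTE yq).
have iq : i \in x :: q by rewrite iE mem_last.
have := next_cycle cq iq.
by rewrite -(permE next_inj) next1 perm1 /mx_edge eqxx.
Qed.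

Lemma connect_mx_edge A k i j : mx_ge0 A -> (A ^+ k) i j != 0 ->
  connect (mx_edge A) i j.
Proof.
move=> A0; elim: k i => [|k IHk] i.
  by rewrite expr0 mxE; case: (i =P j) => [->|_]; rewrite ?eqxx // mulr0n eqxx.
rewrite exprS => /mulmx_neq0P[||l Ail /IHk]; rewrite //; first exact: mx_ge0_exp.
(* A step along a loop is no edge and is skipped. *)
apply: connect_trans; have [->|il] := eqVneq i l; first exact: connect0.
by apply: connect1; rewrite /mx_edge il.
Qed.

Lemma diag_prod_exp_id A k s : mx_ge0 A -> (forall i, A i i != 0) ->
  (forall t, diag_prod t A != 0 -> t = 1%g) ->
  diag_prod s (A ^+ k) != 0 -> s = 1%g.
Proof.
move=> A0 Aii A1 /diag_prod_neq0P As; apply/permP => i; rewrite perm1.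
apply: (mx_edge_acyclic Aii A1); last first.
  exact: connect_mx_edge (As i).
(* The rest of the [s]-orbit leads from [s i] back to [i], so the two vertices reach each other. *)
have := @expmx_perm_neq0 _ s #[s]%g.-1 (s i) (mx_ge0_exp k A0) As.
rewrite -permM -expgS prednK ?order_gt0 // expg_order perm1 -exprM.
exact: connect_mx_edge.
Qed.

Lemma diag_prod_exp_order A t k s : mx_ge0 A -> (forall i, A i (t i) != 0) ->
  (forall u, diag_prod u (A ^+ #[t]%g) != 0 -> u = 1%g) ->
  diag_prod s (A ^+ k) != 0 -> s = (t ^+ k)%g.
Proof.
move=> A0 At At1 /diag_prod_neq0P Ask; apply/eqP; rewrite eq_mulgV1; apply/eqP.
apply: (@diag_prod_exp_id (A ^+ #[t]%g) k _ _ _ At1); first exact: mx_ge0_exp.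
  move=> i; have := @expmx_perm_neq0 A t #[t]%g i A0 At.
  by rewrite expg_order perm1.
apply/diag_prod_neq0P => i; rewrite permM -exprM.
(* The first [k] steps lead from [i] to [s i]; the others follow [t] and amount to [t ^- k]. *)
have -> : (#[t]%g * k = k + k * #[t]%g.-1)%N.
  by rewrite -mulnS prednK ?order_gt0 // mulnC.
rewrite exprD; apply/mulmx_neq0P; try exact: mx_ge0_exp.
exists (s i) => //.
have -> : (t ^- k = t ^+ (k * #[t].-1))%g.
  apply/eqP; rewrite eq_invg_mul -expgD -mulnS prednK ?order_gt0 //.
  by rewrite mulnC expgM expg_order expg1n.
exact: expmx_perm_neq0.
Qed.

Lemma odd_diag_prod_exp A s : mx_ge0 A -> (forall i, A i i != 0) ->
  diag_prod s A != 0 -> s != 1%g ->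
  exists2 t : 'S_n, odd_perm t & diag_prod t (A ^+ #[s]%g) != 0.
Proof.
move=> A0 Aii /diag_prod_neq0P As s1.
have [i si] : exists i, i != s i.
  apply/existsP; apply: contraNT s1; rewrite negb_exists => /forallP h.
  by apply/eqP/permP => i; have := h i; rewrite negbK perm1 => /eqP.
exists (tperm i (s i)); first by rewrite odd_tperm.
have o0 := order_gt0 s.
(* From [i] to [s i] takes one step, the return along [s] takes [#[s]%g.-1], and other points use
   their loop; loops pad all three to length [#[s]%g]. *)
apply/diag_prod_neq0P => j; case: tpermP => [->|->|_ _].
- by apply: (@expmx_loop_neq0 _ 1); rewrite ?expr1.
- apply: (@expmx_loop_neq0 _ #[s]%g.-1); rewrite ?leq_pred //.
  have := @expmx_perm_neq0 _ s #[s]%g.-1 (s i) A0 As.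
  by rewrite -permM -expgS prednK // expg_order perm1.
- by apply: (@expmx_loop_neq0 _ 1); rewrite ?expr1.
Qed.

End NonnegativeMatrices.

Theorem theorem3p8 (R : realType) (n : nat) (A : 'M[R]_n)
    (A_ge0 : forall i j : 'I_n, 0 <= A i j)
    (perA_neq0 : permanent A <> 0) :
  (exists tau : 'S_n, diag_prod 1%g (A *m col_perm_mx R tau) <> 0) /\
  (forall tau : 'S_n,
     diag_prod 1%g (A *m col_perm_mx R tau) <> 0 ->
     ((forall k : nat, (0 < k)%N -> permanent (A ^+ k) = \det (A ^+ k)) <->
      [/\ (tau \in 'Alt_('I_n))%g,
          permanent A = diag_prod tau A &
          permanent (A ^+ #[tau]%g) = diag_prod 1%g (A ^+ #[tau]%g)])).
Proof.
have diagE tau : diag_prod 1%g (A *m col_perm_mx R tau) = diag_prod tau A.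
  by apply: eq_bigr => i _; rewrite mulmx_col_perm perm1.
have Ak0 k : mx_ge0 (A ^+ k) by apply: mx_ge0_exp.
split.
  have [tau At|h] := pickP (fun tau : 'S_n => diag_prod tau A != 0).
    by exists tau; rewrite diagE; apply/eqP.
  by case: perA_neq0; apply: big1 => s _; apply/eqP/negbFE/h.
move=> tau; rewrite diagE => /eqP Atau.
have /diag_prod_neq0P At := Atau.
split=> [perdet|[tau_even _ /permanent_diag_prodP uniq1] k _]; last first.
  (* Only [tau ^+ k] can be supported by [A ^+ k], and it is even with [tau]. *)
  apply/permanent_detP => // s /(diag_prod_exp_order A_ge0 At (uniq1 (Ak0 _))) ->.
  by rewrite -Alt_even groupX.
have even k s : (0 < k)%N -> diag_prod s (A ^+ k) != 0 -> ~~ odd_perm s.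
  by move=> k0; apply: (iffLR (permanent_detP (Ak0 k)) (perdet k k0)).
have o0 := order_gt0 tau.
have uniq1 s : diag_prod s (A ^+ #[tau]%g) != 0 -> s = 1%g.
  move=> As; apply/eqP/negPn/negP => s1.
  have loop i : (A ^+ #[tau]%g) i i != 0.
    by have := @expmx_perm_neq0 _ _ A tau #[tau]%g i A_ge0 At; rewrite expg_order perm1.
  (* An odd permutation supported by the power of [A] with positive exponent [#[tau] * #[s]]
     contradicts [even]. *)
  have [t ot] := odd_diag_prod_exp (Ak0 _) loop As s1.
  by rewrite -exprM => /even; rewrite muln_gt0 o0 order_gt0 ot => /(_ isT).
split; [|apply/permanent_diag_prodP => // s As|exact/permanent_diag_prodP].
- by rewrite Alt_even; apply: (even 1%N); rewrite ?expr1.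
(* The case of exponent 1: what [A] itself supports is [tau ^+ 1]. *)
- by rewrite -[RHS]expg1; apply: (diag_prod_exp_order A_ge0 At uniq1); rewrite expr1.
Qed.
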